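(* Let $\lambda\in\mathbb{C}$ and let $n,j$ be integers with $n\ge0$ and $j\ge1$. Then \[ {n+1 \brack j}_\lambda=\sum_{k=j-1}^n{n \brack k}_\lambda\binom{k}{j-1}\lambda^{k+1-j}={n \brack j-1}_\lambda+\sum_{k=j}^n{n \brack k}_\lambda\binom{k}{j-1}\lambda^{k+1-j}. \]
   Context: For $\lambda\in\mathbb{C}$, the $\lambda$-rising factorial is $\langle x\rangle_{0,\lambda}=1$, $\langle x\rangle_{n,\lambda}=x(x+\lambda)\cdots(x+(n-1)\lambda)$ for $n\ge1$. The unsigned $\lambda$-Stirling numbers of the first kind are defined by $\langle x\rangle_{n,\lambda}=\sum_{k=0}^n {n \brack k}_\lambda x^k$, with the convention ${n \brack k}_\lambda=0$ for $k>n$ or $k<0$. *)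

(* Defs.v *)
From mathcomp Require Import all_boot all_order all_algebra.
From mathcomp Require Import reals complex.

Set Implicit Arguments.
Unset Strict Implicit.
Unset Printing Implicit Defensive.

Import GRing.Theory.
Local Open Scope ring_scope.

Definition lrising (A : comNzRingType) (lambda x : A) (n : nat) : A :=
  \prod_(i < n) (x + lambda *+ i).

(* The coefficient of 'X^k in the lambda-rising factorial of the indeterminate;
   it is 0 for k > n. *)
Definition lstirling1 (A : comNzRingType) (lambda : A) (n k : nat) : A :=
  (lrising lambda%:P 'X n)`_k.

Lemma size_lrisingX (A : comNzRingType) (lambda : A) (n : nat) :
  (size (lrising lambda%:P 'X n) <= n.+1)%N.
Proof.
rewrite /lrising; elim: n => [|n IHn]; first by rewrite big_ord0 size_poly1.
rewrite big_ord_recr /= -polyCMn; apply: leq_trans (size_polyMleq _ _) _.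
by rewrite size_XaddC addn2.
Qed.

Lemma lstirling1_gt (A : comNzRingType) (lambda : A) (n k : nat) :
  (n < k)%N -> lstirling1 lambda n k = 0.
Proof.
by move=> lt_nk; apply: nth_default; apply: leq_trans (size_lrisingX _ _) _.
Qed.

Lemma lrisingE (A : comNzRingType) (lambda x : A) (n : nat) :
  lrising lambda x n = \sum_(k < n.+1) lstirling1 lambda n k * x ^+ k.
Proof.
rewrite -(horner_coef_wide x (size_lrisingX lambda n)) /lrising horner_prod.
by apply: eq_bigr => i _; rewrite -polyCMn hornerD hornerX hornerC.
Qed.

(* Main.v *)
(** Pulling out the first factor gives <x>_(n+1) = x * <x + lambda>_n. Expanding
    <x + lambda>_n in powers of x + lambda, and these by the binomial formula,
    gives the coefficient of x^j on the right-hand side. *)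
Require Import Defs.
From mathcomp Require Import all_boot all_order all_algebra.
From mathcomp Require Import reals complex.

Import GRing.Theory.
Local Open Scope ring_scope.

(** Binomial formula: only the term of index [i = k - m] has degree [m]. No bound on [m] is needed,
    since ['C(k, m)] is 0 for [m > k]. *)
Lemma coef_XaddC_exp (A : comNzRingType) (c : A) (k m : nat) :
  (('X + c%:P) ^+ k)`_m = c ^+ (k - m) *+ 'C(k, m).
Proof.
have coefE i : ('X^(k - i) * c%:P ^+ i *+ 'C(k, i))`_m =
    c ^+ i *+ 'C(k, i) *+ (m == k - i)%N.
  by rewrite coefMn -polyC_exp coefMC coefXn mulr_natl mulrnAC.
rewrite exprDn coef_sum; under eq_bigr do rewrite coefE.
have [le_mk|lt_km] := leqP m k; last first.
  (* Every exponent [k - i] is at most [k < m], so no term contributes. *)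
  rewrite bin_small // big1 // => i _.
  by rewrite gtn_eqF // (leq_ltn_trans (leq_subr _ _)).
have lt_km : (k - m < k.+1)%N by rewrite ltnS leq_subr.
rewrite (bigD1 (Ordinal lt_km)) //= subKn // eqxx bin_sub // big1 ?addr0 //.
move=> i ne_i; case: eqP => // Dm; case/eqP: ne_i; apply: val_inj => /=.
by rewrite Dm subKn // -ltnS.
Qed.

Lemma lrisingSl (A : comNzRingType) (lambda x : A) (n : nat) :
  lrising lambda x n.+1 = x * lrising lambda (x + lambda) n.
Proof.
rewrite /lrising big_ord_recl addr0; congr (_ * _).
by apply: eq_bigr => i _; rewrite lift0 mulrS addrA.
Qed.

Lemma lrising_comp_poly (A : comNzRingType) (lambda : A) (p : {poly A})
    (n : nat) :
  lrising lambda%:P 'X n \Po p = lrising lambda%:P p n.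
Proof.
rewrite /lrising rmorph_prod; apply: eq_bigr => i _ /=.
by rewrite -polyCMn comp_polyD comp_polyX comp_polyC.
Qed.

(** Substitute ['X + lambda%:P] for ['X] in the expansion that defines the Stirling numbers. *)
Lemma lrisingX_shiftE (A : comNzRingType) (lambda : A) (n : nat) :
  lrising lambda%:P ('X + lambda%:P) n =
    \sum_(k < n.+1) lstirling1 lambda n k *: ('X + lambda%:P) ^+ k.
Proof.
rewrite -lrising_comp_poly comp_polyE.
(* [comp_polyE] sums up to the size of the polynomial; the range is widened to [n.+1], the added
   coefficients being 0. *)
rewrite (big_ord_widen _ (fun k => lstirling1 lambda n k *: _ ^+ k)
           (size_lrisingX lambda n)) big_mkcond.
apply: eq_bigr => k _; case: ltnP => // le_k.
by rewrite /lstirling1 nth_default ?scale0r.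
Qed.

Lemma lstirling1_recS (A : comNzRingType) (lambda : A) (n m : nat) :
  lstirling1 lambda n.+1 m.+1 =
    \sum_(m <= k < n.+1)
      lstirling1 lambda n k * 'C(k, m)%:R * lambda ^+ (k - m).
Proof.
rewrite {1}/lstirling1 lrisingSl coefXM /= lrisingX_shiftE coef_sum.
under [LHS]eq_bigr do rewrite coefZ coef_XaddC_exp -mulr_natl mulrA.
rewrite -(big_mkord xpredT
  (fun k => lstirling1 lambda n k * 'C(k, m)%:R * lambda ^+ (k - m))).
(* Here ['C(k, m)] is 0 as [k < m]. This discards the terms below [m] of the full sum, or all of it
   when [m > n.+1]. *)
have vanish (a b : nat) : (b <= m)%N ->
    \sum_(a <= k < b)
      lstirling1 lambda n k * 'C(k, m)%:R * lambda ^+ (k - m) = 0.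
  move=> le_bm; rewrite big_nat_cond big1 // => k /andP[/andP[_ lt_kb] _].
  by rewrite bin_small ?mulr0 ?mul0r // (leq_trans lt_kb).
have [le_mn|lt_nm] := leqP m n.+1.
  by rewrite (big_cat_nat (leq0n m) le_mn) /= vanish ?add0r.
by rewrite vanish ?(ltnW lt_nm) // big_geq // ltnW.
Qed.

Theorem theorem4 (R : realType) (lambda : complex R) (n j : nat)
    (hj : (1 <= j)%N) :
  lstirling1 lambda n.+1 j =
    \sum_(j.-1 <= k < n.+1)
      lstirling1 lambda n k * 'C(k, j.-1)%:R * lambda ^+ (k.+1 - j)
  /\
  \sum_(j.-1 <= k < n.+1)
      lstirling1 lambda n k * 'C(k, j.-1)%:R * lambda ^+ (k.+1 - j) =
    lstirling1 lambda n j.-1 +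
    \sum_(j <= k < n.+1)
      lstirling1 lambda n k * 'C(k, j.-1)%:R * lambda ^+ (k.+1 - j).
Proof.
case: j hj => // m _ /=; split; first exact: lstirling1_recS.
have [le_mn|lt_nm] := leqP m n.
  (* The term [k = m] splits off, with binomial and power of [lambda] both 1. *)
  by rewrite big_ltn // binn subnn mulr1 mulr1.
(* For [n < m] both sums are empty and the isolated Stirling number is 0. *)
by rewrite lstirling1_gt // add0r !big_geq // ltnW.
Qed.
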